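(* The lattice $\mathsf{D}_4$ is not ideal-projective with respect to the class $\mathcal{R}_{\mathrm{mod}}$ of all relatively complemented modular lattices.
   Context: $\mathsf{D}_4$ is the seven-element lattice $\{0,\mathsf{a}_0,\mathsf{a}_1,\mathsf{c},\mathsf{b}_0,\mathsf{b}_1,1\}$ with $\mathsf{a}_0,\mathsf{a}_1$ incomparable, $\mathsf{b}_0,\mathsf{b}_1$ incomparable, $\mathsf{a}_0\wedge\mathsf{a}_1=0$, $\mathsf{a}_0\vee\mathsf{a}_1=\mathsf{c}=\mathsf{b}_0\wedge\mathsf{b}_1$, $\mathsf{b}_0\vee\mathsf{b}_1=1$ (two squares glued top-to-bottom). An ideal of a lattice $L$ is a nonempty subset $I$ with $x\vee y\in I$ iff $x,y\in I$; $\mathrm{Id}\,L$ is the lattice of ideals under inclusion. A lattice $P$ is ideal-projective w.r.t. a class $\mathcal{C}$ if for every $L\in\mathcal{C}$, every lattice homomorphism $\varphi\colon P\to\mathrm{Id}\,L$ and every map $f_0\colon P\to L$ with $f_0(x)\in\varphi(x)$ for all $x$, there is a lattice homomorphism $f\colon P\to L$ with $f(x)\in\varphi(x)$ and $f_0(x)\leq f(x)$ for all $x\in P$. *)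

(* Defs.v *)
From HB Require Import structures.
From mathcomp Require Import all_boot all_order.
From mathcomp Require Import boolp classical_sets.

Set Implicit Arguments.
Unset Strict Implicit.
Unset Printing Implicit Defensive.

Import Order.TTheory.

Local Open Scope order_scope.

(* Order.Lattice has no bounds: R_mod below contains unbounded lattices. *)
Definition lattice_class := forall d, latticeType d -> Prop.

Definition modular : lattice_class := fun d L =>
  forall x y z : L, x <= z -> x `|` (y `&` z) = (x `|` y) `&` z.

(* The complement y automatically lies in the interval [a, b]. *)
Definition relatively_complemented : lattice_class := fun d L =>
  forall a b x : L, a <= x <= b -> exists y : L, x `&` y = a /\ x `|` y = b.

Definition R_mod : lattice_class := fun d L =>
  relatively_complemented L /\ modular L.

Record ideal d (L : latticeType d) := Ideal {
  ideal_set :> set L;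
  ideal_neq0 : nonempty ideal_set;
  idealU : forall x y : L, ideal_set (x `|` y) <-> ideal_set x /\ ideal_set y }.

HB.instance Definition _ d (L : latticeType d) := gen_eqMixin (ideal L).
HB.instance Definition _ d (L : latticeType d) := gen_choiceMixin (ideal L).

Section IdealLattice.
Context d (L : latticeType d).
Implicit Types (I J K : ideal L) (x y z : L).

Lemma ideal_inj I J : ideal_set I = ideal_set J -> I = J.
Proof.
case: I J => [A A0 AU] [B B0 BU] /= AB; move: A0 AU; rewrite AB => A0 AU.
by congr Ideal; exact: Prop_irrelevance.
Qed.

Lemma ideal_down I x y : x <= y -> ideal_set I y -> ideal_set I x.
Proof. by move=> /join_idPl xy; rewrite -xy => /idealU[]. Qed.

Definition ideal_le I J : bool := `[< subset I J >].

Fact ideal_le_refl : reflexive ideal_le.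
Proof. by move=> I; apply/asboolP. Qed.

Fact ideal_le_anti : antisymmetric ideal_le.
Proof.
move=> I J /andP[/asboolP IJ /asboolP JI]; apply: ideal_inj.
by apply/seteqP.
Qed.

Fact ideal_le_trans : transitive ideal_le.
Proof.
move=> J I K /asboolP IJ /asboolP JK; apply/asboolP => x Ix.
exact/JK/IJ.
Qed.

Fact ideal_meet_neq0 I J : nonempty (setI I J).
Proof.
have [x Ix] := ideal_neq0 I; have [y Jy] := ideal_neq0 J.
exists (x `&` y); split; first exact: ideal_down (leIl _ _) Ix.
exact: ideal_down (leIr _ _) Jy.
Qed.

Fact ideal_meetU I J x y :
  setI I J (x `|` y) <-> setI I J x /\ setI I J y.
Proof.
split=> [[/idealU[? ?] /idealU[? ?]]|[[? ?] [? ?]]] //.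
by split; apply/idealU.
Qed.

Definition ideal_meet I J := Ideal (ideal_meet_neq0 I J) (@ideal_meetU I J).

Definition ideal_join_set I J : set L := fun z =>
  exists x y, [/\ ideal_set I x, ideal_set J y & z <= x `|` y].

Fact ideal_join_neq0 I J : nonempty (ideal_join_set I J).
Proof.
have [x Ix] := ideal_neq0 I; have [y Jy] := ideal_neq0 J.
by exists (x `|` y), x, y.
Qed.

Fact ideal_joinU I J x y :
  ideal_join_set I J (x `|` y) <-> ideal_join_set I J x /\ ideal_join_set I J y.
Proof.
split=> [[u [v [Iu Jv]]]|[[u [v [Iu Jv xuv]]] [u' [v' [Iu' Jv' yuv]]]]].
  by rewrite leUx => /andP[? ?]; split; exists u, v.
exists (u `|` u'), (v `|` v'); split; [exact/idealU | exact/idealU |].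
by rewrite joinACA; exact: leU2.
Qed.

Definition ideal_join I J := Ideal (ideal_join_neq0 I J) (@ideal_joinU I J).

End IdealLattice.

Fact ideal_display : Order.disp_t. Proof. exact: Order.Disp tt tt. Qed.

HB.instance Definition _ d (L : latticeType d) :=
  Order.Le_isPOrder.Build ideal_display (ideal L)
    (@ideal_le_refl d L) (@ideal_le_anti d L) (@ideal_le_trans d L).

Section IdealLattice.
Context d (L : latticeType d).
Implicit Types I J K : ideal L.

Fact ideal_lexI I J K : (I <= ideal_meet J K) = (I <= J) && (I <= K).
Proof.
apply/asboolP/andP => [H|[/asboolP IJ /asboolP IK] x Ix].
  by split; apply/asboolP => x /H[].
by split; [exact: IJ | exact: IK].
Qed.

Fact ideal_leUx I J K : (ideal_join I J <= K) = (I <= K) && (J <= K).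
Proof.
have [x0 Ix0] := ideal_neq0 I; have [y0 Jy0] := ideal_neq0 J.
apply/asboolP/andP => [H|[/asboolP IK /asboolP JK] z [x [y [Ix Jy zxy]]]].
  split; apply/asboolP => z Hz; apply: H.
    by exists z, y0; split=> //; exact: leUl.
  by exists x0, z; split=> //; exact: leUr.
by apply: ideal_down zxy _; apply/idealU; split; [exact: IK | exact: JK].
Qed.

End IdealLattice.

HB.instance Definition _ d (L : latticeType d) :=
  Order.POrder_isMeetSemilattice.Build ideal_display (ideal L)
    (@ideal_lexI d L).
HB.instance Definition _ d (L : latticeType d) :=
  Order.POrder_isJoinSemilattice.Build ideal_display (ideal L)
    (@ideal_leUx d L).

Definition ideal_projective (C : lattice_class) d (P : latticeType d) : Prop :=
  forall d' (L : latticeType d'), C d' L ->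
  forall (phi : {lmorphism P -> ideal L}) (f0 : P -> L),
    (forall x, ideal_set (phi x) (f0 x)) ->
  exists f : {lmorphism P -> L},
    forall x, ideal_set (phi x) (f x) /\ f0 x <= f x.

Inductive D4 := D4_0 | D4_a0 | D4_a1 | D4_c | D4_b0 | D4_b1 | D4_1.

Definition D4_code (x : D4) : nat :=
  match x with
  | D4_0 => 0 | D4_a0 => 1 | D4_a1 => 2 | D4_c => 3
  | D4_b0 => 4 | D4_b1 => 5 | D4_1 => 6
  end.

Definition D4_seq := [:: D4_0; D4_a0; D4_a1; D4_c; D4_b0; D4_b1; D4_1].

Fact D4_codeK : cancel D4_code (nth D4_0 D4_seq). Proof. by case. Qed.

HB.instance Definition _ := Countable.copy D4 (can_type D4_codeK).

Fact D4_seqP : Finite.axiom D4_seq. Proof. by case. Qed.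

HB.instance Definition _ := isFinite.Build D4 D4_seqP.

Definition D4_rank (x : D4) : nat :=
  match x with
  | D4_0 => 0 | D4_a0 | D4_a1 => 1 | D4_c => 2 | D4_b0 | D4_b1 => 3 | D4_1 => 4
  end.

Definition D4_le (x y : D4) : bool := (x == y) || (D4_rank x < D4_rank y)%N.

(* The last branch concerns only the incomparable pairs {a0, a1}, {b0, b1}. *)
Definition D4_meet (x y : D4) : D4 :=
  if D4_le x y then x else if D4_le y x then y else
  if D4_rank x == 1 then D4_0 else D4_c.

Definition D4_join (x y : D4) : D4 :=
  if D4_le x y then y else if D4_le y x then x else
  if D4_rank x == 1 then D4_c else D4_1.

Fact D4_le_refl : reflexive D4_le. Proof. by case. Qed.
Fact D4_le_anti : antisymmetric D4_le. Proof. by case; case. Qed.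
Fact D4_le_trans : transitive D4_le. Proof. by case; case; case. Qed.

Fact D4_display : Order.disp_t. Proof. exact: Order.Disp tt tt. Qed.

HB.instance Definition _ :=
  Order.Le_isPOrder.Build D4_display D4 D4_le_refl D4_le_anti D4_le_trans.

Fact D4_lexI (x y z : D4) : (x <= D4_meet y z) = (x <= y) && (x <= z).
Proof. by case: x; case: y; case: z. Qed.

Fact D4_leUx (x y z : D4) : (D4_join x y <= z) = (x <= z) && (y <= z).
Proof. by case: x; case: y; case: z. Qed.

HB.instance Definition _ :=
  Order.POrder_isMeetSemilattice.Build D4_display D4 D4_lexI.
HB.instance Definition _ :=
  Order.POrder_isJoinSemilattice.Build D4_display D4 D4_leUx.

Lemma D4_relations :
  [/\ D4_a0 >< D4_a1 /\ D4_b0 >< D4_b1,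
      D4_a0 `&` D4_a1 = D4_0, D4_a0 `|` D4_a1 = D4_c,
      D4_b0 `&` D4_b1 = D4_c & D4_b0 `|` D4_b1 = D4_1].
Proof. by []. Qed.

(* Main.v *)
Require Import Defs.
From mathcomp Require Import all_boot all_order.
From HB Require Import structures.
From mathcomp Require Import all_algebra.
From mathcomp Require Import boolp classical_sets.

Set Implicit Arguments.
Unset Strict Implicit.
Unset Printing Implicit Defensive.

Import Order.TTheory GRing.Theory.

Local Open Scope ring_scope.

(** Let L be the lattice of all subspaces of V = K[X] x K[X]; every subspace
has a complement by Zorn's lemma, and in a modular lattice this gives relative
complements.  A subspace is bounded when the degrees of its elements are.  Let
phi send c to the ideal of bounded subspaces, a0 and a1 to the bounded subspaces
of the diagonal and of {(X z, X z - z)}, which are complementary in V, and b0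
and b1 to the subspaces with bounded second, respectively first, projection.
If a homomorphism f with values f(x) in phi(x) satisfies K[X] x 0 <= f(b0) and
0 x K[X] <= f(b1), then U = f(c) = f(b0) /\ f(b1) is stable under both
coordinate projections, while U = f(a0) \/ f(a1) is stable under the two
projections attached to the other decomposition of V.  Combining them, (q, 0) in
U implies (X q, 0) in U, so U cannot be both nonzero and bounded. *)

(** * The lattice of subspaces of a vector space *)

Record subspace (K : fieldType) (V : lmodType K) := Subspace {
  subspace_set :> V -> Prop;
  subspace0 : subspace_set 0;
  subspaceP : forall a u v,
    subspace_set u -> subspace_set v -> subspace_set (a *: u + v) }.

HB.instance Definition _ (K : fieldType) (V : lmodType K) :=
  gen_eqMixin (@subspace K V).
HB.instance Definition _ (K : fieldType) (V : lmodType K) :=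
  gen_choiceMixin (@subspace K V).

Section SubspaceOrder.
Context (K : fieldType) (V : lmodType K).
Implicit Types (A B C : subspace V) (a : K) (u v : V).

Lemma subspace_inj A B : subspace_set A = subspace_set B -> A = B.
Proof.
case: A B => [A A0 AP] [B B0 BP] /= AB; move: A0 AP; rewrite AB => A0 AP.
by congr Subspace; exact: Prop_irrelevance.
Qed.

Lemma subspaceD A u v : A u -> A v -> A (u + v).
Proof. by move=> Au Av; rewrite -[u]scale1r; exact: subspaceP. Qed.

Lemma subspaceB A u v : A u -> A v -> A (u - v).
Proof. by move=> Au Av; rewrite addrC -scaleN1r; exact: subspaceP. Qed.

Lemma subspaceZ A a u : A u -> A (a *: u).
Proof.
move=> Au; rewrite -[_ *: _]addr0.
by apply: subspaceP => //; exact: subspace0.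
Qed.

Definition subspace_le A B : bool := `[< subset A B >].

Fact subspace_le_refl : reflexive subspace_le.
Proof. by move=> A; apply/asboolP. Qed.

Fact subspace_le_anti : antisymmetric subspace_le.
Proof.
move=> A B /andP[/asboolP AB /asboolP BA]; apply: subspace_inj.
exact/seteqP.
Qed.

Fact subspace_le_trans : transitive subspace_le.
Proof.
move=> B A C /asboolP AB /asboolP BC; apply/asboolP => u Au.
exact/BC/AB.
Qed.

Fact subspace_meetP A B a u v :
  setI A B u -> setI A B v -> setI A B (a *: u + v).
Proof. by move=> [? ?] [? ?]; split; exact: subspaceP. Qed.

Definition subspace_meet A B :=
  Subspace (conj (subspace0 A) (subspace0 B)) (@subspace_meetP A B).

Definition subspace_sum A B : set V := fun w =>
  exists u v, [/\ A u, B v & w = u + v].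

Fact subspace_sum0 A B : subspace_sum A B 0.
Proof. by exists 0, 0; rewrite addr0; split=> //; exact: subspace0. Qed.

Fact subspace_sumP A B a u v : subspace_sum A B u -> subspace_sum A B v ->
  subspace_sum A B (a *: u + v).
Proof.
move=> [x [y [Ax By ->]]] [x' [y' [Ax' By' ->]]].
exists (a *: x + x'), (a *: y + y').
by split; [exact: subspaceP|exact: subspaceP|rewrite scalerDr addrACA].
Qed.

Definition subspace_join A B :=
  Subspace (subspace_sum0 A B) (@subspace_sumP A B).

End SubspaceOrder.

Fact subspace_display : Order.disp_t. Proof. exact: Order.Disp tt tt. Qed.

HB.instance Definition _ (K : fieldType) (V : lmodType K) :=
  Order.Le_isPOrder.Build subspace_display (subspace V)
    (@subspace_le_refl K V) (@subspace_le_anti K V) (@subspace_le_trans K V).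

Section SubspaceLattice.
Context (K : fieldType) (V : lmodType K).
Implicit Types (A B C : subspace V) (a : K) (u v : V).

Lemma subspace_leP A B : reflect (forall u, A u -> B u) (A <= B)%O.
Proof. exact: asboolP. Qed.

Lemma subspace_leS A B u : (A <= B)%O -> A u -> B u.
Proof. by move=> /subspace_leP; exact. Qed.

Fact subspace_lexI A B C :
  (A <= subspace_meet B C)%O = (A <= B)%O && (A <= C)%O.
Proof.
apply/subspace_leP/andP => [H|[/subspace_leP AB /subspace_leP AC] u Au];
  last by split; auto.
by split; apply/subspace_leP => u /H[].
Qed.

Fact subspace_leUx A B C :
  (subspace_join A B <= C)%O = (A <= C)%O && (B <= C)%O.
Proof.
apply/subspace_leP/andP => [H|[/subspace_leP AC /subspace_leP BC] _
  [u [v [Au Bv ->]]]].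
  split; apply/subspace_leP => u Hu; apply: H.
    by exists u, 0; rewrite addr0; split=> //; exact: subspace0.
  by exists 0, u; rewrite add0r; split=> //; exact: subspace0.
by apply: subspaceD; auto.
Qed.

End SubspaceLattice.

HB.instance Definition _ (K : fieldType) (V : lmodType K) :=
  Order.POrder_isMeetSemilattice.Build subspace_display (subspace V)
    (@subspace_lexI K V).
HB.instance Definition _ (K : fieldType) (V : lmodType K) :=
  Order.POrder_isJoinSemilattice.Build subspace_display (subspace V)
    (@subspace_leUx K V).

(** * Modularity and relative complements *)

Section SubspaceTheory.
Context (K : fieldType) (V : lmodType K).
Implicit Types (A B C : subspace V) (a : K) (u v : V).

(** Built with [Defined], like the concrete subspaces below, so that membership unfolds to the plain
    equation [u = 0]. *)
Definition null : subspace V.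
Proof.
by exists (set1 0) => //= a u v -> ->; rewrite scaler0 addr0.
Defined.

Definition full : subspace V.
Proof. by exists setT. Defined.

Lemma null_le A : (null <= A)%O.
Proof. by apply/subspace_leP => u ->; exact: subspace0. Qed.

Lemma full_ge A : (A <= full)%O.
Proof. exact/subspace_leP. Qed.

Lemma subspace_modular : modular (subspace V).
Proof.
move=> A B C leAC; apply: le_anti; rewrite leUx !lexI leUl leAC leIr /=.
rewrite (le_trans (leIl _ _) (leUr _ _)) /=.
apply/subspace_leP => _ [[u [v [Au Bv ->]]] Cuv].
exists u, v; split=> //; split=> //; rewrite -[v](addKr u) addrC.
by apply: subspaceB => //; exact: (subspace_leS leAC).
Qed.

Lemma subspace_complement A : exists B, (A `&` B = null /\ A `|` B = full)%O.
Proof.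
(* Membership of 0 is not imposed, so that the empty chain has a bound. *)
pose P : set (set V) := fun Y =>
  (forall a u v, Y u -> Y v -> Y (a *: u + v)) /\
  forall u, A u -> Y u -> u = 0.
have /Zorn_bigcup[Y [[YP AY] Ymax]] :
    forall F : set (set V), (F `<=` P)%classic -> total_on F subset ->
    P (\bigcup_(X in F) X)%classic.
  move=> F FP Ftot; split=> [a u v [X FX Xu] [Z FZ Zv]|u Au [X FX Xu]].
    have [XZ|ZX] := Ftot _ _ FX FZ.
      by exists Z => //; apply: (FP Z FZ).1 => //; exact: XZ.
    by exists X => //; apply: (FP X FX).1 => //; exact: ZX.
  exact: (FP X FX).2 Xu.
have max Z : P Z -> (Y `<=` Z)%classic -> (Z `<=` Y)%classic.
  move=> PZ YZ; apply: contrapT => ZY; exact: Ymax PZ.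
have Y0 : Y 0.
  (* Adjoining 0 to [Y] preserves [P], so maximality puts 0 in [Y]. For closure, [a *: u + 0] is in
     [Y] as soon as some [u] is, because [0 = - u + u]. *)
  apply: (max (fun u => Y u \/ u = 0)) => [|u Yu|]; [split|by left|by right].
    move=> a u v [Yu|->] [Yv|->]; rewrite ?scaler0 ?add0r ?addr0; auto.
    left; rewrite -[_ *: u]addr0; apply: (YP) => //.
    by rewrite -(addNr u) -scaleN1r; exact: (YP).
  by move=> u Au [/AY->|].
exists (Subspace Y0 YP); split; apply: le_anti;
  rewrite ?null_le ?full_ge ?andbT /=.
  by apply/subspace_leP => u [Au Yu]; exact: AY.
apply/subspace_leP => b _; apply: contrapT => nb.
suff Yb : Y b.
  by apply: nb; exists 0, b; rewrite add0r; split=> //; exact: subspace0.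
(* The span of [b] and [Y] still meets [A] only in 0: if [k *: b + y] is in [A] with [k != 0],
   dividing by [k] writes [b] as an element of [A] plus one of [Y], against [nb]. *)
apply: (max (fun w => exists k y, Y y /\ w = k *: b + y)).
- split=> [a _ _ [k [y [Yy ->]]] [k' [y' [Yy' ->]]]|w Aw [k [y [Yy wE]]]].
    exists (a * k + k'), (a *: y + y'); split; first exact: (YP).
    by rewrite scalerDr scalerDl addrACA scalerA.
  rewrite {w}wE in Aw *; have [k0|kn0] := eqVneq k 0.
    by move: Aw; rewrite k0 scale0r add0r => /AY->.
  case: nb; exists (k^-1 *: (k *: b + y)), (- (k^-1 *: y)).
  split; first exact: subspaceZ.
    by rewrite -scaleN1r scalerA -[_ *: _]addr0; exact: (YP).
  by rewrite scalerDr scalerA mulVf// scale1r addrK.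
- by move=> y Yy; exists 0, y; rewrite scale0r add0r.
- by exists 1, 0; rewrite scale1r addr0.
Qed.

Lemma subspace_relatively_complemented :
  relatively_complemented (subspace V).
Proof.
move=> A B X /andP[AX XB]; have [Y [XY0 XY1]] := subspace_complement X.
(* A complement [Y] of [X] in the whole lattice is pushed into the interval from [A] to [B]; the
   modular law evaluates both the meet and the join with [X]. *)
exists (A `|` (Y `&` B))%O; split.
  rewrite meetC -subspace_modular// [(_ `&` X)%O]meetAC (meetC Y X) XY0.
  by apply: join_idPl; exact: le_trans (leIl _ _) (null_le _).
rewrite joinA (join_idPl AX) subspace_modular// XY1.
exact/meet_idPr/full_ge.
Qed.

End SubspaceTheory.

(** * Ideals generated by nondecreasing chains *)

Section ChainIdeal.
Context d (L : latticeType d).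
Implicit Types Q R : nat -> L.
Local Open Scope order_scope.

Definition nondecreasing Q := forall m n, (m <= n)%N -> Q m <= Q n.

Section Def.
Variables (Q : nat -> L) (hQ : nondecreasing Q).

Definition chain_ideal_set : set L := fun x => exists n, x <= Q n.

Fact chain_ideal_neq0 : nonempty chain_ideal_set.
Proof. by exists (Q 0), 0. Qed.

Fact chain_idealU x y :
  chain_ideal_set (x `|` y) <-> chain_ideal_set x /\ chain_ideal_set y.
Proof.
split=> [[n]|[[m xm] [n yn]]].
  by rewrite leUx => /andP[xn yn]; split; exists n.
exists (maxn m n); rewrite leUx (le_trans xm) ?(le_trans yn) //.
  by apply: hQ; rewrite leq_maxr.
by apply: hQ; rewrite leq_maxl.
Qed.

Definition chain_ideal := Ideal chain_ideal_neq0 chain_idealU.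

End Def.

Lemma chain_ideal_meet Q R S (hQ : nondecreasing Q) (hR : nondecreasing R)
    (hS : nondecreasing S) : (forall n, Q n `&` R n = S n) ->
  chain_ideal hQ `&` chain_ideal hR = chain_ideal hS.
Proof.
move=> QRS; apply: ideal_inj; apply/seteqP; split=> x /=.
  move=> [[m xm] [n xn]]; exists (maxn m n); rewrite -QRS lexI.
  rewrite (le_trans xm) ?(le_trans xn)//.
    by apply: hR; rewrite leq_maxr.
  by apply: hQ; rewrite leq_maxl.
by move=> [n]; rewrite -QRS lexI => /andP[? ?]; split; exists n.
Qed.

(** The index shift in the second hypothesis costs nothing, as an ideal forgets indices; it leaves
    room for a decomposition that raises degrees by one, as in [bounded_split]. *)
Lemma chain_ideal_join Q R S (hQ : nondecreasing Q) (hR : nondecreasing R)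
    (hS : nondecreasing S) : (forall n, Q n `|` R n <= S n) ->
    (forall n, S n <= Q n.+1 `|` R n.+1) ->
  chain_ideal hQ `|` chain_ideal hR = chain_ideal hS.
Proof.
move=> QRS SQR; apply: ideal_inj; apply/seteqP; split=> x /=.
  move=> [u [v [[m um] [n vn] xuv]]]; exists (maxn m n).
  apply: le_trans xuv (le_trans _ (QRS _)); apply: leU2.
    by rewrite (le_trans um)//; apply: hQ; rewrite leq_maxl.
  by rewrite (le_trans vn)//; apply: hR; rewrite leq_maxr.
move=> [n xn]; exists (Q n.+1), (R n.+1).
by split; [exists n.+1|exists n.+1|exact: le_trans (SQR n)].
Qed.

End ChainIdeal.

(** * Homomorphisms out of [D4] *)

Lemma D4_incomparable (x y : D4) : (x >< y)%O ->
  (x, y) \in [:: (D4_a0, D4_a1); (D4_a1, D4_a0);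
                 (D4_b0, D4_b1); (D4_b1, D4_b0)].
Proof. by case: x; case: y. Qed.

(** The four equations make [g] monotone, which settles comparable pairs; the incomparable pairs are
    exactly the middles of the two squares, where the equations apply directly. *)
Lemma D4_lmorphism d (L : latticeType d) (g : D4 -> L) :
  (g D4_a0 `&` g D4_a1 = g D4_0)%O -> (g D4_a0 `|` g D4_a1 = g D4_c)%O ->
  (g D4_b0 `&` g D4_b1 = g D4_c)%O -> (g D4_b0 `|` g D4_b1 = g D4_1)%O ->
  exists phi : {lmorphism D4 -> L}, phi =1 g.
Proof.
move=> a0 ac bc b1.
have [l1 l2] : (g D4_0 <= g D4_a0 /\ g D4_0 <= g D4_a1)%O.
  by rewrite -a0 leIl leIr.
have [l3 l4] : (g D4_a0 <= g D4_c /\ g D4_a1 <= g D4_c)%O.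
  by rewrite -ac leUl leUr.
have [l5 l6] : (g D4_c <= g D4_b0 /\ g D4_c <= g D4_b1)%O.
  by rewrite -bc leIl leIr.
have [l7 l8] : (g D4_b0 <= g D4_1 /\ g D4_b1 <= g D4_1)%O.
  by rewrite -b1 leUl leUr.
have gmono : {homo g : x y / (x <= y)%O}.
  have l0c := le_trans l1 l3; have lcb := le_trans l5 l7.
  have la0b0 := le_trans l3 l5; have la0b1 := le_trans l3 l6.
  have la1b0 := le_trans l4 l5; have la1b1 := le_trans l4 l6.
  have l0b0 := le_trans l1 la0b0; have l0b1 := le_trans l1 la0b1.
  have l01 := le_trans l0c lcb.
  have la01 := le_trans l3 lcb; have la11 := le_trans l4 lcb.
  by case; case.
have gI : Order.meet_morphism g.
  move=> x y; case: (boolP (x >=< y)%O) => [/orP[] xy|].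
  - by rewrite (meet_idPl xy) (meet_idPl (gmono _ _ xy)).
  - by rewrite (meet_idPr xy) (meet_idPr (gmono _ _ xy)).
  move=> /D4_incomparable; rewrite !inE => /or4P[] /eqP[-> ->].
  - by rewrite a0.
  - by rewrite [RHS]meetC a0.
  - by rewrite bc.
  - by rewrite [RHS]meetC bc.
have gU : Order.join_morphism g.
  move=> x y; case: (boolP (x >=< y)%O) => [/orP[] xy|].
  - by rewrite (join_idPr xy) (join_idPr (gmono _ _ xy)).
  - by rewrite (join_idPl xy) (join_idPl (gmono _ _ xy)).
  move=> /D4_incomparable; rewrite !inE => /or4P[] /eqP[-> ->].
  - by rewrite ac.
  - by rewrite [RHS]joinC ac.
  - by rewrite b1.
  - by rewrite [RHS]joinC b1.
by exists (Order.LatticeMorphism.pack_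
  (Order.isMeetLatticeMorphism.Build _ _ _ _ g gI)
  (Order.isJoinLatticeMorphism.Build _ _ _ _ g gU)
  (Order.isOrderMorphism.Build _ _ _ _ g gmono)).
Qed.

(** * The counterexample in K[X] x K[X] *)

Section Counterexample.
Variable K : fieldType.
Local Notation V := ({poly K} * {poly K})%type.
Implicit Types (p : V) (n : nat).

Definition first_axis : subspace V.
Proof.
by exists (fun p => p.2 = 0) => //= a u v -> ->; rewrite scaler0 addr0.
Defined.

Definition second_axis : subspace V.
Proof.
by exists (fun p => p.1 = 0) => //= a u v -> ->; rewrite scaler0 addr0.
Defined.

Definition diagonal : subspace V.
Proof. by exists (fun p => p.1 = p.2) => //= a u v -> ->. Defined.

Definition shift_graph : subspace V.
Proof.
exists (fun p => p.1 = (p.1 - p.2) * 'X) => /=; first by rewrite subrr mul0r.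
move=> a [u1 u2] [v1 v2] /= hu hv.
by rewrite opprD addrACA -scalerBr mulrDl -scalerAl -hu -hv.
Defined.

Fact size_lincomb_poly n a (q r : {poly K}) :
  (size q <= n -> size r <= n -> size (a *: q + r)%R <= n)%N.
Proof.
move=> qn rn; rewrite (leq_trans (size_polyD _ _))// geq_max rn andbT.
exact: leq_trans (size_scale_leq _ _) qn.
Qed.

Definition bounded1 n : subspace V.
Proof.
exists (fun p => size p.1 <= n)%N; first by rewrite size_poly0.
by move=> a u v; exact: size_lincomb_poly.
Defined.

Definition bounded2 n : subspace V.
Proof.
exists (fun p => size p.2 <= n)%N; first by rewrite size_poly0.
by move=> a u v; exact: size_lincomb_poly.
Defined.

(** The factors follow the order of [D4_b0] and [D4_b1], so that the relation for [D4_c] holds by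
    conversion. *)
Definition bounded n : subspace V := (bounded2 n `&` bounded1 n)%O.

Definition D4_chain n (x : D4) : subspace V :=
  match x with
  | D4_0 => null V
  | D4_a0 => (diagonal `&` bounded n)%O
  | D4_a1 => (shift_graph `&` bounded n)%O
  | D4_c => bounded n
  | D4_b0 => bounded2 n
  | D4_b1 => bounded1 n
  | D4_1 => full V
  end.

Lemma D4_chain_nondecreasing x : nondecreasing (D4_chain ^~ x).
Proof.
have m1 : nondecreasing bounded1.
  by move=> m n mn; apply/subspace_leP => p /= pm; exact: leq_trans mn.
have m2 : nondecreasing bounded2.
  by move=> m n mn; apply/subspace_leP => p /= pm; exact: leq_trans mn.
have m12 : nondecreasing bounded.
  by move=> m n mn; apply: leI2; [exact: m2|exact: m1].
by move=> m n mn; case: x => //=;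
  [apply: leI2|apply: leI2|exact: m12|exact: m2|exact: m1] => //; exact: m12.
Qed.

Lemma diagonal_meet_shift_graph : (diagonal `&` shift_graph)%O = null V.
Proof.
apply: le_anti; rewrite null_le andbT; apply/subspace_leP => -[q r] [/= ->].
by rewrite subrr mul0r => ->.
Qed.

Lemma bounded_split n :
  (bounded n <= (diagonal `&` bounded n.+1) `|`
                (shift_graph `&` bounded n.+1))%O.
Proof.
apply/subspace_leP => -[q r] [/= rn qn].
have sN (s t : {poly K}) m :
    (size s <= m -> size t <= m -> size (s - t)%R <= m)%N.
  by move=> sm tm; rewrite addrC -scaleN1r; exact: size_lincomb_poly.
have zn : (size (q - r)%R <= n)%N by exact: sN.
have Xzn : (size ((q - r) * 'X)%R <= n.+1)%N.
  by rewrite (leq_trans (size_polyMleq _ _))// size_polyX addn2.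
have [rn' qn' zn'] := And3 (leqW rn) (leqW qn) (leqW zn).
(* Diagonal vectors have coordinate difference 0, so the component in [shift_graph] must have the
   difference [z = q - r] of the given pair, hence be [(z X, z X - z)]. The factor [X] accounts for
   the bound [n.+1]. *)
exists (q - (q - r) * 'X, q - (q - r) * 'X),
  ((q - r) * 'X, (q - r) * 'X - (q - r)).
split.
- by split=> //; split=> /=; exact: sN.
- split; first by rewrite /= subKr.
  by split=> //=; exact: sN.
- by rewrite -[RHS]/(_, _); congr pair; rewrite ?subrK// addrA subrK subKr.
Qed.

Lemma bounded2_join n : (bounded2 n `|` bounded1 n)%O = full V.
Proof.
apply: le_anti; rewrite full_ge /=; apply/subspace_leP => -[q r] _.
exists (q, 0), (0, r); split; rewrite /= ?size_poly0//.
by rewrite -[RHS]/(_, _); congr pair; rewrite ?addr0 ?add0r.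
Qed.

Lemma D4_ideal_lmorphism : exists phi : {lmorphism D4 -> ideal (subspace V)},
  phi =1 fun x => chain_ideal (@D4_chain_nondecreasing x).
Proof.
apply: D4_lmorphism.
- apply: chain_ideal_meet => n /=.
  rewrite meetACA diagonal_meet_shift_graph; exact/meet_idPl/null_le.
- by apply: chain_ideal_join => n; [rewrite leUx !leIr|exact: bounded_split].
- exact: chain_ideal_meet.
- by apply: chain_ideal_join => n /=; rewrite bounded2_join.
Qed.

Definition line (p0 : V) : subspace V.
Proof.
exists (fun p => exists a, p = a *: p0); first by exists 0; rewrite scale0r.
move=> a _ _ [b ->] [c ->]; exists (a * b + c).
by rewrite scalerDl scalerA.
Defined.

Lemma line_mem p0 : line p0 p0.
Proof. by exists 1; rewrite scale1r. Qed.

(** The two axes make [f D4_c] stable under the coordinate projections; the line through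
    [(X, X - 1)], the element of [shift_graph] with [z = 1], makes it nonzero. *)
Definition D4_choice (x : D4) : subspace V :=
  match x with
  | D4_a1 => line ('X, 'X - 1)
  | D4_b0 => first_axis
  | D4_b1 => second_axis
  | _ => null V
  end.

Lemma D4_choice_mem x :
  ideal_set (chain_ideal (@D4_chain_nondecreasing x)) (D4_choice x).
Proof.
(* 2 is the size of both ['X] and ['X - 1]; the axes meet their bounds at every index. *)
exists 2%N; case: x; try exact: null_le; apply/subspace_leP => p /=.
- move=> [a ->]; apply: (@subspaceZ _ _ (shift_graph `&` bounded 2)%O).
  split; first by rewrite /= subKr mul1r.
  by split=> /=; rewrite ?size_XsubC ?size_polyX.
- by move=> ->; rewrite size_poly0.
- by move=> ->; rewrite size_poly0.
Qed.

Lemma D4_no_section (f : {lmorphism D4 -> subspace V}) :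
  (forall x, ideal_set (chain_ideal (@D4_chain_nondecreasing x)) (f x)) ->
  ~ (forall x, D4_choice x <= f x)%O.
Proof.
move=> fin fge; have [n /subspace_leP fcn] := fin D4_c.
have fX0 : (f D4_a0 <= diagonal)%O.
  by have [m /le_trans->] := fin D4_a0; rewrite ?leIl.
have fX1 : (f D4_a1 <= shift_graph)%O.
  by have [m /le_trans->] := fin D4_a1; rewrite ?leIl.
have fcU : f D4_c = (f D4_a0 `|` f D4_a1)%O by rewrite -omorphU.
have fcI : f D4_c = (f D4_b0 `&` f D4_b1)%O by rewrite -omorphI.
have [fcb0 fcb1] : (f D4_c <= f D4_b0)%O /\ (f D4_c <= f D4_b1)%O.
  by rewrite fcI leIl leIr.
(* Projection to the first coordinate: [(q, 0)] lies in [f D4_b0] as a point of the first axis, and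
   in [f D4_b1] as [(q, r)] minus a point of the second axis. *)
have fcE0 (q r : {poly K}) : f D4_c (q, r) -> f D4_c (q, 0).
  move=> fcqr; rewrite fcI; split.
    by apply: (subspace_leS (fge D4_b0)).
  have -> : (q, 0) = (q, r) - (0, r) :> V.
    by rewrite -[RHS]/(_, _) subr0 subrr.
  apply: subspaceB; first exact: (subspace_leS fcb1).
  by apply: (subspace_leS (fge D4_b1)).
(* The [shift_graph] component [v] of [(q, 0)] has coordinate difference [q], hence first coordinate
   [q * 'X]; it lies in [f D4_a1], so in [f D4_c], and [fcE0] projects it. *)
have fcX (q : {poly K}) : f D4_c (q, 0) -> f D4_c (q * 'X, 0).
  rewrite {1}fcU => -[[u1 u2] [[v1 v2] [fu fv [qE rE]]]].
  have u12 : u1 = u2 := subspace_leS fX0 fu.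
  have v1E : v1 = (v1 - v2) * 'X := subspace_leS fX1 fv.
  have -> : q * 'X = v1.
    rewrite v1E qE u12; congr (_ * _).
    by apply/eqP; rewrite eq_sym subr_eq addrAC -rE add0r.
  apply: (fcE0 _ v2); rewrite fcU; exists 0, (v1, v2).
  by rewrite add0r; split=> //; exact: subspace0.
have Xn m : f D4_c ('X^(m.+1), 0).
  elim: m => [|m IHm]; last by rewrite exprSr; exact: fcX.
  apply: (fcE0 _ ('X - 1)); rewrite fcU; exists 0, ('X, 'X - 1).
  rewrite add0r; split=> //; first exact: subspace0.
  exact: (subspace_leS (fge D4_a1)) (line_mem _).
(* ['X^(n.+1)] has size [n.+2], beyond the bound [n] on [f D4_c]. *)
by have [_ /=] := fcn _ (Xn n); rewrite size_polyXn ltnNge leqnSn.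
Qed.

End Counterexample.

Theorem theorem4p3 : ~ ideal_projective R_mod D4.
Proof.
have [phi phiE] := D4_ideal_lmorphism rat.
move=> /(_ _ (subspace ({poly rat} * {poly rat})%type)).
move=> /(_ (conj (@subspace_relatively_complemented _ _)
               (@subspace_modular _ _))).
move=> /(_ phi (@D4_choice rat))[x|f fP].
  by rewrite phiE; exact: D4_choice_mem.
by apply: (@D4_no_section _ f) => x; have [] := fP x; rewrite ?phiE.
Qed.
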